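(* Let $\mathcal X_1,\mathcal X_2$ be finite sets of secret input values, let $\mathcal W_1,\mathcal W_2$ be sets of guesses, and let $g_1:\mathcal W_1\times\mathcal X_1\to[0,1]$ and $g_2:\mathcal W_2\times\mathcal X_2\to[0,1]$ be gain functions. For any prior $\pi$ on $\mathcal X_1\times\mathcal X_2$ and any joint gain function $g:(\mathcal W_1\times\mathcal W_2)\times(\mathcal X_1\times\mathcal X_2)\to[0,1]$ for $g_1,g_2$, $M^{\min}_{g,\pi}>0$.
   Context: A prior on a finite set is a probability distribution on it. A joint gain function $g$ for $g_1,g_2$ is required to satisfy: $g((w_1,w_2),(x_1,x_2))=0$ if and only if $g_1(w_1,x_1)g_2(w_2,x_2)=0$ (no other relation is assumed). The marginals of $\pi$ are $\pi_1[x_1]=\sum_{x_2\in\mathcal X_2}\pi[x_1,x_2]$ and $\pi_2[x_2]=\sum_{x_1\in\mathcal X_1}\pi[x_1,x_2]$. For $w_1\in\mathcal W_1,w_2\in\mathcal W_2$ let $\mathcal S_{w_1,w_2}=\{(x_1,x_2)\in\mathcal X_1\times\mathcal X_2:\pi[x_1,x_2]\cdot g((w_1,w_2),(x_1,x_2))\ne0\}$, and define $$M^{\min}_{g,\pi}=\min_{w_1\in\mathcal W_1,\,w_2\in\mathcal W_2}\ \min_{(x_1,x_2)\in\mathcal S_{w_1,w_2}}\frac{\pi_1[x_1]g_1(w_1,x_1)\cdot\pi_2[x_2]g_2(w_2,x_2)}{\pi[x_1,x_2]\cdot g((w_1,w_2),(x_1,x_2))}.$$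
   Formalization: The sets of guesses are assumed both finite, or else the minimum defining M^min is assumed to be attained (for infinite guess sets it may not exist and the infimum may be 0); the minimum over an empty support is taken to be +∞. *)

(* Defs.v *)
From mathcomp Require Import all_boot all_order all_algebra.
From mathcomp Require Import all_classical all_reals ereal.

Set Implicit Arguments.
Unset Strict Implicit.
Unset Printing Implicit Defensive.
Import Order.TTheory GRing.Theory Num.Theory.
Local Open Scope classical_set_scope.
Local Open Scope ring_scope.

Definition is_prior (R : realType) (X : finType) (pi : X -> R) : Prop :=
  (forall x, 0 <= pi x) /\ \sum_(x : X) pi x = 1.

Definition is_gain (R : realType) (W : Type) (X : finType)
    (g : W -> X -> R) : Prop :=
  forall w x, 0 <= g w x <= 1.

Definition is_joint_gain (R : realType) (W1 W2 : Type) (X1 X2 : finType)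
    (g1 : W1 -> X1 -> R) (g2 : W2 -> X2 -> R)
    (g : W1 * W2 -> X1 * X2 -> R) : Prop :=
  is_gain g /\
  forall w1 w2 x1 x2,
    g (w1, w2) (x1, x2) = 0 <-> g1 w1 x1 * g2 w2 x2 = 0.

Section Mmin.
Variables (R : realType) (W1 W2 : Type) (X1 X2 : finType).
Variables (pi : X1 * X2 -> R) (g1 : W1 -> X1 -> R) (g2 : W2 -> X2 -> R).
Variable g : W1 * W2 -> X1 * X2 -> R.

Definition marginal1 (x1 : X1) : R := \sum_(x2 : X2) pi (x1, x2).
Definition marginal2 (x2 : X2) : R := \sum_(x1 : X1) pi (x1, x2).

Definition gain_supp (w : W1 * W2) : {set X1 * X2} :=
  [set x | pi x * g w x != 0]%SET.

Definition gain_ratio (w : W1 * W2) (x : X1 * X2) : R :=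
  (marginal1 x.1 * g1 w.1 x.1 * (marginal2 x.2 * g2 w.2 x.2))
  / (pi x * g w x).

(* The minimum over an empty support is +oo, so that guesses with an empty
   support do not affect the outer minimum. *)
Definition min_ratio (w : W1 * W2) : \bar R :=
  \big[Order.min/+oo%E]_(x in gain_supp w) (gain_ratio w x)%:E.

(* W1 and W2 may be infinite, hence an infimum; it is a minimum exactly when
   Mmin_attained holds, in particular when W1 and W2 are finite and nonempty. *)
Definition Mmin : \bar R := ereal_inf (range min_ratio).

Definition Mmin_attained : Prop := exists w, min_ratio w = Mmin.

End Mmin.

(* Main.v *)
(** A pair x in the support of a guess w has pi x > 0 and g w x > 0. Each
    marginal dominates pi, and g w x <> 0 forces both individual gains to be
    nonzero, so every ratio is positive; a minimum of positive values is
    positive. *)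
Require Import Defs.
From mathcomp Require Import all_boot all_order all_algebra.
From mathcomp Require Import all_classical all_reals ereal.

Set Implicit Arguments.
Unset Strict Implicit.
Unset Printing Implicit Defensive.
Import Order.TTheory GRing.Theory Num.Theory.
Local Open Scope classical_set_scope.
Local Open Scope ring_scope.

Lemma le_marginal1 (R : realType) (X1 X2 : finType) (pi : X1 * X2 -> R)
    (pi_ge0 : forall x, 0 <= pi x) (x : X1 * X2) :
  pi x <= marginal1 pi x.1.
Proof.
rewrite /marginal1 (bigD1 x.2) //= -surjective_pairing lerDl.
exact: sumr_ge0.
Qed.

Lemma le_marginal2 (R : realType) (X1 X2 : finType) (pi : X1 * X2 -> R)
    (pi_ge0 : forall x, 0 <= pi x) (x : X1 * X2) :
  pi x <= marginal2 pi x.2.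
Proof.
rewrite /marginal2 (bigD1 x.1) //= -surjective_pairing lerDl.
exact: sumr_ge0.
Qed.

Lemma gain_ratio_gt0 (R : realType) (X1 X2 : finType) (W1 W2 : Type)
    (g1 : W1 -> X1 -> R) (g2 : W2 -> X2 -> R) (pi : X1 * X2 -> R)
    (g : W1 * W2 -> X1 * X2 -> R) (w : W1 * W2) (x : X1 * X2) :
  is_gain g1 -> is_gain g2 -> is_prior pi -> is_joint_gain g1 g2 g ->
  x \in gain_supp pi g w -> 0 < gain_ratio pi g1 g2 g w x.
Proof.
case: w x => [w1 w2] [x1 x2] hg1 hg2 [pi_ge0 _] [hg g0].
rewrite inE mulf_eq0 negb_or => /andP[pi_neq0 g_neq0].
have pi_gt0 : 0 < pi (x1, x2) by rewrite lt0r pi_neq0 pi_ge0.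
have g_gt0 : 0 < g (w1, w2) (x1, x2).
  by rewrite lt0r g_neq0; case/andP: (hg (w1, w2) (x1, x2)).
(* Only the zero pattern links [g] to [g1] and [g2]: by [g0], a vanishing product would force [g] to
   vanish at this point. *)
have : g1 w1 x1 * g2 w2 x2 != 0.
  by apply: contra g_neq0 => /eqP /g0 ->.
rewrite mulf_eq0 negb_or => /andP[g1_neq0 g2_neq0].
have g1_gt0 : 0 < g1 w1 x1 by rewrite lt0r g1_neq0; case/andP: (hg1 w1 x1).
have g2_gt0 : 0 < g2 w2 x2 by rewrite lt0r g2_neq0; case/andP: (hg2 w2 x2).
have pi1_gt0 := lt_le_trans pi_gt0 (le_marginal1 pi_ge0 (x1, x2)).
have pi2_gt0 := lt_le_trans pi_gt0 (le_marginal2 pi_ge0 (x1, x2)).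
by rewrite /gain_ratio divr_gt0 ?mulr_gt0.
Qed.

Lemma min_ratio_gt0 (R : realType) (X1 X2 : finType) (W1 W2 : Type)
    (g1 : W1 -> X1 -> R) (g2 : W2 -> X2 -> R) (pi : X1 * X2 -> R)
    (g : W1 * W2 -> X1 * X2 -> R) (w : W1 * W2) :
  is_gain g1 -> is_gain g2 -> is_prior pi -> is_joint_gain g1 g2 g ->
  (0 < min_ratio pi g1 g2 g w)%E.
Proof.
(* The seed [+oo] is positive too, which settles guesses with empty support. *)
move=> hg1 hg2 hpi hg; apply: lt_bigmin => [|x xS]; first exact: ltry.
by rewrite lte_fin gain_ratio_gt0.
Qed.

(** A strict bound survives a finite minimum but in general not an infimum, so the infimum is
    compared with the minimum over a list enumerating [A]. For empty [A] both are [+oo], whence the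
    condition on [a]. *)
Lemma finite_ereal_inf_gt (R : realType) (A : set (\bar R)) (a : \bar R) :
  (a < +oo)%E -> finite_set A -> (forall x, A x -> (a < x)%E) ->
  (a < ereal_inf A)%E.
Proof.
move=> a_lty /finite_seqP[s ->] a_lt.
apply: (@lt_le_trans _ _ (\big[Order.min/+oo%E]_(x <- s) x)).
  (* [big_seq] keeps the membership in [s] that [a_lt] asks for. *)
  by rewrite big_seq; apply: lt_bigmin.
by apply: le_ereal_inf_tmp => x /= xs; apply: (ge_bigmin_seq _ _ xpredT id xs).
Qed.

(** Infinitely many positive ratios may have infimum 0. [hmin] excludes this: either the guesses are
    finite in number, or the infimum is itself some [min_ratio]. *)
Theorem proposition3p4 (R : realType) (X1 X2 : finType) (W1 W2 : Type)
    (g1 : W1 -> X1 -> R) (g2 : W2 -> X2 -> R)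
    (hg1 : is_gain g1) (hg2 : is_gain g2)
    (pi : X1 * X2 -> R) (hpi : is_prior pi)
    (g : W1 * W2 -> X1 * X2 -> R) (hg : is_joint_gain g1 g2 g)
    (hmin : (finite_set [set: W1] /\ finite_set [set: W2]) \/
            Mmin_attained pi g1 g2 g) :
  (0 < Mmin pi g1 g2 g)%E.
Proof.
have ratio_gt0 w : (0 < min_ratio pi g1 g2 g w)%E by apply: min_ratio_gt0.
case: hmin => [[finW1 finW2]|[w <-]]; last exact: ratio_gt0.
apply: finite_ereal_inf_gt => [||_ [w _ <-]] //.
(* The values form the image of the set of all guess pairs, a product of two finite sets. *)
by apply: finite_image; rewrite -setXTT; apply: finite_setX.
Qed.
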